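(* Let $f:\mathbb{R}^n\to\mathbb{R}$ be twice-differentiable and suppose there are constants $0<\mu\le L$ such that $\mu I\preceq\nabla^2 f(x)\preceq L I$ for all $x\in\mathbb{R}^n$ (i.e. $f$ is $\mu$-strongly convex with $L$-Lipschitz continuous gradient), and that the Hessian is $M$-Lipschitz continuous: $\|\nabla^2 f(x)-\nabla^2 f(y)\|\le M\|x-y\|$ for all $x,y\in\mathbb{R}^n$. Let $x_*$ be the minimizer of $f$. Let $x_k\in\mathbb{R}^n$ and $\alpha_k\in\mathbb{R}$ be arbitrary, and let $$x_{k+1}=x_k-\alpha_k\nabla^2 f(x_k)^{-1}\nabla f(x_k).$$ Then $$\|x_{k+1}-x_*\|\le|\alpha_k|\,\frac{M}{2\mu}\,\|x_k-x_*\|^2+|\alpha_k-1|\,\frac{L}{\mu}\,\|x_k-x_*\|.$$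
   Context: Here $A\preceq B$ for symmetric matrices means $B-A$ is positive semidefinite, and $I$ is the $n\times n$ identity matrix. The norm $\|\cdot\|$ is the Euclidean norm for vectors and the spectral norm for matrices. *)

(* Defs.v *)
From HB Require Import structures.
From mathcomp Require Import all_boot all_order all_algebra.
From mathcomp Require Import boolp classical_sets functions reals.
From mathcomp Require Import topology normedtype derive.

Set Implicit Arguments.
Unset Strict Implicit.
Unset Printing Implicit Defensive.

Import Order.TTheory GRing.Theory Num.Theory.
Import numFieldNormedType.Exports.

Local Open Scope classical_set_scope.
Local Open Scope ring_scope.

(* The norm [`|x|] that the library puts on matrices is the max norm. It is
   used here only through [differentiable] and ['D_v], which do not depend on
   the choice of a norm in finite dimension. *)
Definition enorm (R : realType) (n : nat) (x : 'cV[R]_n) : R :=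
  Num.sqrt (\sum_(i < n) x i 0 ^+ 2).

(* The set is nonempty and bounded above, so [sup] is an actual supremum. *)
Definition spectral_norm (R : realType) (m n : nat) (A : 'M[R]_(m, n)) : R :=
  sup [set enorm (A *m v) | v in [set v : 'cV[R]_n | enorm v <= 1]].

Definition gradient (R : realType) (n : nat) (f : 'cV[R]_n -> R)
    (x : 'cV[R]_n) : 'cV[R]_n :=
  \col_(i < n) 'D_(delta_mx i 0) f x.

Definition hessian (R : realType) (n : nat) (f : 'cV[R]_n -> R)
    (x : 'cV[R]_n) : 'M[R]_n :=
  \matrix_(i < n, j < n) 'D_(delta_mx j 0) ('D_(delta_mx i 0) f) x.

(* Fréchet differentiability of f and of its gradient; this makes [hessian f]
   the matrix of the differential of [gradient f]. *)
Definition twice_differentiable (R : realType) (n : nat)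
    (f : 'cV[R]_n -> R) : Prop :=
  (forall x, differentiable f x) /\ (forall x, differentiable (gradient f) x).

(* Symmetry is not part of this predicate. It is meant for symmetric matrices,
   such as the Hessian of a twice (Fréchet) differentiable function. *)
Definition psdmx (R : realType) (n : nat) (A : 'M[R]_n) : Prop :=
  forall v : 'cV[R]_n, 0 <= (v^T *m A *m v) 0 0.

Definition loewner_le (R : realType) (n : nat) (A B : 'M[R]_n) : Prop :=
  psdmx (B - A).

Definition is_minimizer (R : realType) (n : nat) (f : 'cV[R]_n -> R)
    (x : 'cV[R]_n) : Prop :=
  forall y, f x <= f y.

(* Main.v *)
(* Put e = xk - xstar, H = hessian f xk and r = H e - gradient f xk. Then
   xk1 - xstar = alphak H^-1 r + (1 - alphak) e. Since H is coercive with
   constant mu, |H^-1 r| <= |r| / mu. As the gradient vanishes at xstar, r is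
   the second-order Taylor remainder of the gradient, so the Lipschitz bound on
   the Hessian gives |r| <= (M / 2) |e|^2; it is obtained by applying the mean
   value theorem to the scalar product of the remainder with a fixed vector,
   which avoids integrating. The factor L / mu only enters through
   1 <= L / mu. *)
Require Import Defs.
From HB Require Import structures.
From mathcomp Require Import all_boot all_order all_algebra.
From mathcomp Require Import boolp classical_sets functions reals.
From mathcomp Require Import topology normedtype derive.
From mathcomp Require Import ring lra.

Import Order.TTheory GRing.Theory Num.Theory.
Import numFieldNormedType.Exports.

Local Open Scope ring_scope.

Lemma sub_mxE (V : zmodType) m n (A B : 'M[V]_(m, n)) i j :
  (A - B) i j = A i j - B i j.
Proof. by rewrite !mxE. Qed.

Lemma sum_sqr_ge0 (R : realType) (I : finType) (a : I -> R) :
  0 <= \sum_i a i ^+ 2.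
Proof. by apply: sumr_ge0 => i _; exact: sqr_ge0. Qed.

Lemma cauchy_schwarz_sum (R : realType) (I : finType) (a b : I -> R) :
  (\sum_i a i * b i) ^+ 2 <= (\sum_i a i ^+ 2) * (\sum_i b i ^+ 2).
Proof.
(* Lagrange's identity *)
have : 0 <= \sum_i \sum_j (a i * b j - a j * b i) ^+ 2.
  by apply: sumr_ge0 => i _; exact: sum_sqr_ge0.
have -> : \sum_i \sum_j (a i * b j - a j * b i) ^+ 2 =
    (\sum_i a i ^+ 2) * (\sum_i b i ^+ 2) * 2 - (\sum_i a i * b i) ^+ 2 * 2.
  rewrite [X in _ = X - _]mulr_natr mulr2n [X in _ + X - _]mulrC expr2.
  rewrite !big_distrlr /= mulr_suml -big_split /= -sumrB; apply: eq_bigr => i _.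
  rewrite mulr_suml -big_split /= -sumrB; apply: eq_bigr => j _; ring.
lra.
Qed.

(** * Cauchy-Schwarz and the triangle inequality for column vectors *)

Section EuclideanNorm.
Local Set Implicit Arguments.
Local Unset Strict Implicit.
Variables (R : realType) (n : nat).
Implicit Types (u v w : 'cV[R]_n).

Lemma enorm_ge0 v : 0 <= enorm v.
Proof. exact: sqrtr_ge0. Qed.

Lemma enorm_dot v : enorm v ^+ 2 = (v^T *m v) 0 0.
Proof.
rewrite sqr_sqrtr ?sum_sqr_ge0// mxE.
by apply: eq_bigr => i _; rewrite mxE expr2.
Qed.

Lemma enorm_sqr v : enorm v ^+ 2 = \sum_i v i 0 ^+ 2.
Proof. by rewrite sqr_sqrtr ?sum_sqr_ge0. Qed.

Lemma cauchy_schwarz u v : `|(u^T *m v) 0 0| <= enorm u * enorm v.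
Proof.
rewrite -ler_sqr ?nnegrE ?mulr_ge0 ?enorm_ge0// exprMn !enorm_sqr real_normK ?num_real//.
rewrite mxE (eq_bigr (fun i => u i 0 * v i 0)); last by move=> i _; rewrite mxE.
exact: cauchy_schwarz_sum.
Qed.

Lemma enorm_eq0 v : enorm v = 0 -> v = 0.
Proof.
move=> v0; apply/colP => i; apply/eqP; rewrite [in X in _ == X]mxE -sqrf_eq0.
have : \sum_i v i 0 ^+ 2 == 0 by rewrite -enorm_sqr v0 expr0n.
rewrite psumr_eq0 => [/allP/(_ i)|j _]; last exact: sqr_ge0.
by rewrite mem_index_enum => /(_ isT).
Qed.

Lemma enormZ c v : enorm (c *: v) = `|c| * enorm v.
Proof.
rewrite /enorm -sqrtr_sqr -sqrtrM ?sqr_ge0// mulr_sumr.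
by congr Num.sqrt; apply: eq_bigr => i _; rewrite mxE exprMn.
Qed.

Lemma enormD u v : enorm (u + v) <= enorm u + enorm v.
Proof.
rewrite -ler_sqr ?nnegrE ?addr_ge0 ?enorm_ge0// sqrrD !enorm_sqr.
have -> : \sum_i (u + v) i 0 ^+ 2 = \sum_i u i 0 ^+ 2 +
    (u^T *m v) 0 0 *+ 2 + \sum_i v i 0 ^+ 2.
  rewrite mxE -sumrMnl -!big_split; apply: eq_bigr => i _ /=.
  by rewrite !mxE; ring.
by rewrite lerD2r lerD2l lerMn2r /= (le_trans (ler_norm _))// cauchy_schwarz.
Qed.

End EuclideanNorm.

(** * The spectral norm as an operator bound *)

Section SpectralNorm.
Local Set Implicit Arguments.
Local Unset Strict Implicit.
Variables (R : realType) (m n : nat) (A : 'M[R]_(m, n)).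

(** Cauchy-Schwarz on each row. This crude bound shows that the supremum defining [spectral_norm] is
    finite. *)
Lemma enorm_mulmx_le_frobenius (v : 'cV[R]_n) :
  enorm (A *m v) <= Num.sqrt (\sum_i \sum_j A i j ^+ 2) * enorm v.
Proof.
rewrite /enorm -sqrtrM; last by apply: sumr_ge0 => i _; exact: sum_sqr_ge0.
apply: ler_wsqrtr; rewrite mulr_suml; apply: ler_sum => i _.
by rewrite mxE; exact: cauchy_schwarz_sum.
Qed.

Lemma has_ubound_spectral_norm : has_ubound
  [set enorm (A *m v) | v in [set v : 'cV[R]_n | enorm v <= 1]]%classic.
Proof.
exists (Num.sqrt (\sum_i \sum_j A i j ^+ 2)) => _ [v /= v1 <-].
by rewrite (le_trans (enorm_mulmx_le_frobenius v))// ler_piMr// sqrtr_ge0.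
Qed.

Lemma spectral_norm_ge0 : 0 <= spectral_norm A.
Proof.
apply: le_trans (enorm_ge0 (A *m 0)) _.
apply: ub_le_sup; first exact: has_ubound_spectral_norm.
by exists 0 => //=; rewrite -(scale0r 0) enormZ normr0 mul0r.
Qed.

Lemma enorm_mulmx_le (v : 'cV[R]_n) :
  enorm (A *m v) <= spectral_norm A * enorm v.
Proof.
(* A vector of norm zero cannot be normalized; the Frobenius bound settles that case. *)
have [v0|v_neq0] := eqVneq (enorm v) 0.
  by have := enorm_mulmx_le_frobenius v; rewrite v0 !mulr0.
have v_gt0 : 0 < enorm v by rewrite lt_neqAle eq_sym v_neq0 enorm_ge0.
rewrite -ler_pdivrMr//.
apply: ub_le_sup; first exact: has_ubound_spectral_norm.
exists ((enorm v)^-1 *: v) => /=.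
  by rewrite enormZ ger0_norm ?invr_ge0 ?enorm_ge0// mulVf.
by rewrite -scalemxAr enormZ ger0_norm ?invr_ge0 ?enorm_ge0// mulrC.
Qed.

End SpectralNorm.

(** * Invertibility and inverse bound for a coercive matrix *)

Section Coercive.
Local Set Implicit Arguments.
Local Unset Strict Implicit.
Variables (R : realType) (n : nat) (mu : R) (A : 'M[R]_n).
Hypotheses (mu_gt0 : 0 < mu) (muA : loewner_le mu%:M A).

(** Divide mu |v|^2 <= v^T A v <= |v| |A v| by |v|. *)
Lemma loewner_lower_bound (v : 'cV[R]_n) : mu * enorm v <= enorm (A *m v).
Proof.
have [->|v_neq0] := eqVneq (enorm v) 0; first by rewrite mulr0 enorm_ge0.
have v_gt0 : 0 < enorm v by rewrite lt_neqAle eq_sym v_neq0 enorm_ge0.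
have := muA v; rewrite mulmxBr mulmxBl mul_mx_scalar -scalemxAl -mulmxA.
rewrite sub_mxE subr_ge0 [X in X <= _]mxE -enorm_dot => le_muA.
have := le_trans le_muA (le_trans (ler_norm _) (cauchy_schwarz _ _)).
by rewrite expr2 mulrCA ler_pM2l.
Qed.

(** The lower bound makes the kernel trivial. Since [kermx] is a left kernel, it is taken of the
    transpose: the transposes of its rows are vectors killed by [A]. *)
Lemma loewner_unitmx : A \in unitmx.
Proof.
rewrite -unitmx_tr -row_free_unit -kermx_eq0; apply/eqP/row_matrixP => i.
rewrite row0; apply: (can_inj trmxK); rewrite trmx0; apply: enorm_eq0.
apply/eqP; rewrite -(mulrI_eq0 _ (mulfI (lt0r_neq0 mu_gt0))) eq_le.
rewrite (le_trans (loewner_lower_bound _)) ?mulr_ge0 ?enorm_ge0 ?(ltW mu_gt0)//.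
rewrite -[X in X *m _]trmxK -trmx_mul -row_mul mulmx_ker row0 trmx0.
by rewrite -(scale0r 0) enormZ normr0 mul0r.
Qed.

Lemma enorm_invmx_le (v : 'cV[R]_n) : enorm (invmx A *m v) <= enorm v / mu.
Proof.
rewrite ler_pdivlMr// mulrC (le_trans (loewner_lower_bound _))//.
by rewrite mulKVmx// loewner_unitmx.
Qed.

End Coercive.

(** * Derivatives along lines and the Taylor bound for the gradient *)

Section Gradient.
Local Set Implicit Arguments.
Local Unset Strict Implicit.
Variables (R : realType) (n : nat).
Implicit Types (f : 'cV[R]_n -> R) (x v w : 'cV[R]_n).

Lemma is_derive_line f x v (t : R) : derivable f (x + t *: v) v ->
  is_derive t 1 (fun s => f (x + s *: v)) ('D_v f (x + t *: v)).
Proof.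
have e : (fun h : R => h^-1 *: (f (x + (h *: 1 + t) *: v) - f (x + t *: v))) =
    (fun h : R => h^-1 *: (f (h *: v + (x + t *: v)) - f (x + t *: v))).
  apply/funext => h; congr (_ *: (f _ - _)).
  by rewrite -[h *: 1]/(h * 1) mulr1 scalerDl addrCA.
move=> dfv; apply: DeriveDef.
  by rewrite /derivable /= e.
by rewrite /derive /= e.
Qed.

(** Linearity of the differential, applied to the expansion of [v] in the canonical basis. *)
Lemma derive_sum_partial f x v : differentiable f x ->
  'D_v f x = \sum_i v i 0 * 'D_(delta_mx i 0) f x.
Proof.
move=> df; rewrite deriveE// [in LHS](matrix_sum_delta v) linear_sum.
by apply: eq_bigr => i _; rewrite big_ord1 linearZ /= -deriveE//.
Qed.

(** Fermat's rule in one variable on each coordinate line through [x]; uniqueness of the derivative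
    at 0 concludes. *)
Lemma gradient_minimizer f x : (forall y, differentiable f y) ->
  is_minimizer f x -> gradient f x = 0.
Proof.
move=> df fmin; apply/colP => i; rewrite !mxE.
set v := delta_mx i 0.
have dline (t : R) :
    is_derive t 1 (fun s => f (x + s *: v)) ('D_v f (x + t *: v)).
  by apply: is_derive_line; exact: diff_derivable.
have min0 : is_derive (0 : R) 1 (fun t => f (x + t *: v)) 0.
  apply: (@derive1_at_min R _ (-1) 1) => [|t _||t _].
  - lra.
  - by have := dline t; exact: @ex_derive.
  - by rewrite in_itv /=; lra.
  - by rewrite scale0r addr0; exact: fmin.
have := dline 0; rewrite scale0r addr0 => dline0.
by rewrite -(@derive_val _ _ _ _ _ _ _ dline0) (@derive_val _ _ _ _ _ _ _ min0).
Qed.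

Lemma is_derive_gradient f x v : differentiable (gradient f) x ->
  forall i, is_derive x v (fun y => gradient f y i 0) ((hessian f x *m v) i 0).
Proof.
move=> dg i.
have dgi : differentiable (fun y => gradient f y i 0) x.
  apply: (@differentiable_comp _ _ _ _ (gradient f) (fun N : 'cV[R]_n => N i 0)) => //.
  exact: differentiable_coord.
apply: DeriveDef; first exact: diff_derivable.
rewrite derive_sum_partial// mxE; apply: eq_bigr => j _; rewrite mxE mulrC.
by congr (_ * _); congr ('D_ _ _ _); apply/funext => y; rewrite mxE.
Qed.

(** Pairing with a fixed [w] gives a scalar function, to which the mean value theorem can be
    applied. *)
Lemma is_derive_dot_gradient f x v w : differentiable (gradient f) x ->
  is_derive x v (fun y => (w^T *m gradient f y) 0 0)
    ((w^T *m (hessian f x *m v)) 0 0).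
Proof.
move=> dg; have dgi := is_derive_gradient v dg.
have -> : (fun y => (w^T *m gradient f y) 0 0) =
    \sum_(i < n) (w i 0 \*: (fun y => gradient f y i 0)).
  apply/funext => y; rewrite mxE fct_sumE.
  by apply: eq_bigr => i _; rewrite mxE.
have -> : (w^T *m (hessian f x *m v)) 0 0 =
    \sum_i w i 0 *: (hessian f x *m v) i 0.
  by rewrite mxE; apply: eq_bigr => i _; rewrite mxE.
exact: is_derive_sum.
Qed.

Lemma gradient_taylor f M x y : (forall z, differentiable (gradient f) z) ->
  (forall z, spectral_norm (hessian f z - hessian f x) <= M * enorm (z - x)) ->
  enorm (gradient f y - gradient f x - hessian f x *m (y - x)) <=
    M / 2 * enorm (y - x) ^+ 2.
Proof.
move=> dg hessM; set v := y - x; set w := gradient f y - _ - _.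
have [->|w_neq0] := eqVneq (enorm w) 0.
  (* No sign of [M] is given; nonnegativity comes from the Lipschitz bound at [y]. *)
  have : 0 <= M * enorm v.
    by apply: le_trans (hessM y); exact: spectral_norm_ge0.
  by move=> /mulr_ge0 /(_ (enorm_ge0 v)); lra.
have w_gt0 : 0 < enorm w by rewrite lt_neqAle eq_sym w_neq0 enorm_ge0.
(* The fixed vector is the remainder [w] itself, so that its product with the remainder is |w|^2. *)
pose g t := (w^T *m gradient f (x + t *: v)) 0 0.
pose b := (w^T *m (hessian f x *m v)) 0 0.
(* [K] is chosen so that 2 t K, the derivative of t^2 K, equals the Lipschitz bound |w| (M |t v|)
   |v| for t >= 0. *)
pose K := M / 2 * enorm v ^+ 2 * enorm w.
pose h (t : R) := g t - t * b - t ^+ 2 * K.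
pose dh (t : R) := (w^T *m (hessian f (x + t *: v) *m v)) 0 0 - b - 2 * t * K.
have derh (t : R) : is_derive t 1 h (dh t).
  have dgt := is_derive_dot_gradient v w (dg (x + t *: v)).
  have : is_derive t 1 g ((w^T *m (hessian f (x + t *: v) *m v)) 0 0).
    rewrite -(@derive_val _ _ _ _ _ _ _ dgt); apply: is_derive_line.
    exact: ex_derive.
  move=> dgt'.
  (* In this point-free form the derivative is found by instance inference. *)
  have -> : h = g - (b \*: @id R) - (K \*: (@id R) ^+ 2).
    by apply/funext => s; rewrite /h !fctE /= mulrC [_ ^+ 2 * K]mulrC.
  by apply: is_derive_eq; rewrite /dh /GRing.scale /= expr1; ring.
have [|c /andP[c0 c1] hc] := @MVT_segment R h dh 0 1 ler01 (fun t _ => derh t).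
  apply: derivable_within_continuous => t _; exact: ex_derive.
have dh_le0 : dh c <= 0.
  have -> : dh c = (w^T *m ((hessian f (x + c *: v) - hessian f x) *m v)) 0 0
      - 2 * c * K.
    by rewrite /dh /b mulmxBl (mulmxBr w^T) sub_mxE.
  rewrite subr_le0 (le_trans (ler_norm _))// (le_trans (cauchy_schwarz _ _))//.
  have -> : 2 * c * K = enorm w * (M * enorm (c *: v) * enorm v).
    by rewrite enormZ ger0_norm// /K; field.
  rewrite ler_pM2l// (le_trans (enorm_mulmx_le _ _))// ler_wpM2r ?enorm_ge0//.
  by have := hessM (x + c *: v); rewrite addrAC subrr add0r.
have : h 1 <= h 0 by rewrite -subr_le0 hc subr0 mulr1.
rewrite /h /g scale0r addr0 scale1r [x + v]addrC subrK !mul1r expr1n mul1r.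
rewrite mul0r expr0n mul0r !subr0 -subr_le0.
(* Thus h 1 <= h 0 says |w|^2 <= K, and cancelling |w| gives the claim. *)
have -> : (w^T *m gradient f y) 0 0 - b - K - (w^T *m gradient f x) 0 0 =
    enorm w ^+ 2 - K.
  have -> : enorm w ^+ 2 = (w^T *m gradient f y) 0 0
      - (w^T *m gradient f x) 0 0 - b.
    by rewrite enorm_dot /b -!sub_mxE -!mulmxBr.
  by ring.
by rewrite subr_le0 expr2 /K ler_pM2r.
Qed.

End Gradient.

Theorem proposition3 (R : realType) (n : nat) (f : 'cV[R]_n -> R)
    (mu L M : R) (xstar xk xk1 : 'cV[R]_n) (alphak : R)
    (hf : twice_differentiable f)
    (hmu : 0 < mu) (hmuL : mu <= L)
    (hessian_bounds : forall x : 'cV[R]_n,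
      loewner_le mu%:M (hessian f x) /\ loewner_le (hessian f x) L%:M)
    (hessian_lipschitz : forall x y : 'cV[R]_n,
      spectral_norm (hessian f x - hessian f y) <= M * enorm (x - y))
    (hxstar : is_minimizer f xstar)
    (hxk1 : xk1 = xk - alphak *: (invmx (hessian f xk) *m gradient f xk)) :
  enorm (xk1 - xstar) <=
    `|alphak| * (M / (2 * mu)) * enorm (xk - xstar) ^+ 2 +
    `|alphak - 1| * (L / mu) * enorm (xk - xstar).
Proof.
have [df dg] := hf; have mu_neq0 := lt0r_neq0 hmu.
pose e := xk - xstar; pose H := hessian f xk.
(* Written as the remainder of the expansion at [xk], evaluated at [xstar], to match
   [gradient_taylor]. *)
pose r := gradient f xstar - gradient f xk - H *m (xstar - xk).
have [muH _] := hessian_bounds xk.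
have -> : xk1 - xstar = alphak *: (invmx H *m r) + (1 - alphak) *: e.
  rewrite /r gradient_minimizer// sub0r -[xstar - xk]opprB mulmxN opprK.
  rewrite mulmxDr mulmxN mulKmx ?(loewner_unitmx hmu)//.
  (* Once the Newton direction is abstracted as [p], the identity is checked coordinatewise. *)
  rewrite hxk1 -/H; move: (invmx H *m _) => p.
  by apply/colP => i; rewrite !mxE; ring.
rewrite (le_trans (enormD _ _))// !enormZ lerD//.
  rewrite -!mulrA ler_wpM2l// (le_trans (enorm_invmx_le hmu muH _))//.
  rewrite ler_pdivrMr//; apply: le_trans.
    by apply: (gradient_taylor (M := M)) => // z; exact: hessian_lipschitz.
  rewrite -opprB -scaleN1r enormZ normrN1 mul1r -/e.
  by rewrite le_eqVlt; apply/orP; left; apply/eqP; field.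
rewrite distrC ler_wpM2r ?enorm_ge0// ler_peMr//.
by rewrite ler_pdivlMr// mul1r.
Qed.
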